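(* Let $\alpha:I\to\mathbb{I}^3$ be an admissible unit speed curve in simply isotropic space, with Frenet frame $\{\mathbf t,\mathbf n,\mathbf b\}$, curvature $\kappa$ and torsion $\tau$, and fix $s_0\in I$. Let $\mathbf n_1$ be a unit normal vector field along $\alpha$. If $\mathbf n_1$ is rotation minimizing (RM) and $\{\mathbf t,\mathbf n_1,\mathbf b\}$ has the same orientation as the Frenet frame, then $$\mathbf n_1(s)=\mathbf n(s)-\left(\int_{s_0}^s\tau(x)\,\mathrm dx+\tau_0\right)\mathbf b(s),$$ where $\tau_0$ is a constant. In addition, the RM frame $\{\mathbf t,\mathbf n_1,\mathbf n_2=\mathbf b\}$ satisfies $$\frac{\mathrm d}{\mathrm ds}\begin{pmatrix}\mathbf t\\ \mathbf n_1\\ \mathbf n_2\end{pmatrix}=\begin{pmatrix}0&\kappa_1&\kappa_2\\-\kappa_1&0&0\\0&0&0\end{pmatrix}\begin{pmatrix}\mathbf t\\ \mathbf n_1\\ \mathbf n_2\end{pmatrix},$$ where the natural curvatures are $\kappa_1=\kappa=\kappa\,\mathrm{cosg}\,\theta$ and $\kappa_2=\kappa\,\theta=\kappa\,\mathrm{sing}\,\theta$, with $\mathrm{sing}[\theta(s)]=\theta(s)=\int_{s_0}^s\tau(x)\,\mathrm dx+\tau_0$.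
   Context: Simply isotropic space $\mathbb{I}^3$ is $\mathbb{R}^3$ with the degenerate inner product $\langle\mathbf u,\mathbf v\rangle_z=u_1v_1+u_2v_2$ and $\Vert\mathbf u\Vert_z=\sqrt{\langle\mathbf u,\mathbf u\rangle_z}$. A curve $\alpha=(x,y,z):I\to\mathbb{I}^3$ on an interval $I$ is parametrized by arc-length (unit speed) if $\Vert\alpha'(s)\Vert_z=1$ for all $s$. A unit speed curve is admissible if it has no inflection point ($\alpha',\alpha''$ are linearly independent everywhere) and $x'y''-x''y'\neq0$ everywhere. Curves are assumed differentiable enough (e.g. $C^3$) for all derivatives written to exist and be continuous. Frenet frame: $\mathbf t=\alpha'$, $\kappa=\Vert\mathbf t'\Vert_z$ (which is nonzero), $\mathbf n=\mathbf t'/\kappa$, $\mathbf b=(0,0,1)$. It is a basis of $\mathbb{R}^3$ at each point and satisfies $\mathbf t'=\kappa\mathbf n$, $\mathbf n'=-\kappa\mathbf t+\tau\mathbf b$, $\mathbf b'=0$, where the second equation defines the torsion $\tau$. A vector field $\mathbf v$ along $\alpha$ is normal if $\langle\mathbf v,\mathbf t\rangle_z=0$ and unit if $\langle\mathbf v,\mathbf v\rangle_z=1$. A normal vector field $\mathbf v$ is rotation minimizing (RM) if $\mathbf v'=\mu\,\mathbf t$ for some function $\mu$. An RM frame is a frame $\{\mathbf t,\mathbf n_1,\mathbf n_2=\mathbf b\}$ with $\mathbf n_1$ a unit RM normal field such that the frame has the same orientation (same sign of determinant) as the Frenet frame. Galilean trigonometric functions: $\mathrm{cosg}\,\phi=1$,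 $\mathrm{sing}\,\phi=\phi$. *)

(* Defs.v *)
From Stdlib Require Import Reals ClassicalEpsilon.
From Coquelicot Require Import Coquelicot.

Open Scope R_scope.

Definition nondegenerate_interval (I : R -> Prop) : Prop :=
  (forall x y z, I x -> I z -> x <= y <= z -> I y) /\
  (exists x y, I x /\ I y /\ x < y).

(** Differentiation relative to a set [I]. On a nondegenerate interval this is
    the usual derivative at interior points and the one-sided derivative at an
    end point belonging to [I]; it is then unique, so that the value chosen by
    [Derive_on] is the derivative whenever there is one. *)
Definition is_derive_on {V : NormedModule R_AbsRing}
    (I : R -> Prop) (f : R -> V) (s : R) (l : V) : Prop :=
  filterdiff f (within I (locally s)) (fun h : R => scal h l).

Definition ex_derive_on {V : NormedModule R_AbsRing}
    (I : R -> Prop) (f : R -> V) (s : R) : Prop :=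
  exists l : V, is_derive_on I f s l.

Definition Derive_on {V : NormedModule R_AbsRing}
    (I : R -> Prop) (f : R -> V) (s : R) : V :=
  epsilon (inhabits zero) (is_derive_on I f s).

Fixpoint C_on {V : NormedModule R_AbsRing}
    (k : nat) (I : R -> Prop) (f : R -> V) : Prop :=
  match k with
  | O => continuous_on I f
  | S k' => (forall s, I s -> ex_derive_on I f s) /\ C_on k' I (Derive_on I f)
  end.

(** The vector space operations of [vec], and its topology, are those of
    Coquelicot's product normed module. *)
Notation vec := (R * R * R)%type.

Definition xc (v : vec) : R := fst (fst v).
Definition yc (v : vec) : R := snd (fst v).
Definition zc (v : vec) : R := snd v.

Definition inner_z (u v : vec) : R := xc u * xc v + yc u * yc v.
Definition norm_z (u : vec) : R := sqrt (inner_z u u).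

Definition det3 (u v w : vec) : R :=
  xc u * (yc v * zc w - zc v * yc w)
  - yc u * (xc v * zc w - zc v * xc w)
  + zc u * (xc v * yc w - yc v * xc w).

Definition lin_indep (u v : vec) : Prop :=
  forall a b : R, plus (scal a u) (scal b v) = zero -> a = 0 /\ b = 0.

Definition comb (a b c : R) (u v w : vec) : vec :=
  plus (plus (scal a u) (scal b v)) (scal c w).

Definition unit_speed (I : R -> Prop) (alpha : R -> vec) : Prop :=
  forall s, I s -> norm_z (Derive_on I alpha s) = 1.

Definition admissible (I : R -> Prop) (alpha : R -> vec) : Prop :=
  forall s, I s ->
    let a1 := Derive_on I alpha s in
    let a2 := Derive_on I (Derive_on I alpha) s in
    lin_indep a1 a2 /\ xc a1 * yc a2 - xc a2 * yc a1 <> 0.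

Definition tangent (I : R -> Prop) (alpha : R -> vec) : R -> vec :=
  Derive_on I alpha.

Definition curvature (I : R -> Prop) (alpha : R -> vec) (s : R) : R :=
  norm_z (Derive_on I (tangent I alpha) s).

Definition normal (I : R -> Prop) (alpha : R -> vec) (s : R) : vec :=
  scal (/ curvature I alpha s) (Derive_on I (tangent I alpha) s).

Definition binormal (s : R) : vec := (0, 0, 1).

(** The coefficient [r] in n' = - kappa t + r b; it is unique since the z
    component of [binormal] is 1. *)
Definition torsion (I : R -> Prop) (alpha : R -> vec) (s : R) : R :=
  epsilon (inhabits 0) (fun r : R =>
    Derive_on I (normal I alpha) s =
    plus (scal (- curvature I alpha s) (tangent I alpha s)) (scal r (binormal s))).

Definition normal_field (I : R -> Prop) (alpha v : R -> vec) : Prop :=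
  forall s, I s -> inner_z (v s) (tangent I alpha s) = 0.

Definition unit_field (I : R -> Prop) (v : R -> vec) : Prop :=
  forall s, I s -> inner_z (v s) (v s) = 1.

Definition rotation_minimizing (I : R -> Prop) (alpha v : R -> vec) : Prop :=
  normal_field I alpha v /\
  exists mu : R -> R,
    forall s, I s -> is_derive_on I v s (scal (mu s) (tangent I alpha s)).

Definition frenet_oriented (I : R -> Prop) (alpha v : R -> vec) : Prop :=
  forall s, I s ->
    sign (det3 (tangent I alpha s) (v s) (binormal s)) =
    sign (det3 (tangent I alpha s) (normal I alpha s) (binormal s)).

Definition cosg (phi : R) : R := 1.
Definition sing (phi : R) : R := phi.

(* Main.v *)
Require Import Defs.
From Stdlib Require Import Reals Lra ClassicalEpsilon.
From Coquelicot Require Import Coquelicot.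

Open Scope R_scope.

(** The degenerate inner product only sees the top view of a vector, its
    projection to the xy-plane.  There a unit normal field has no freedom but a
    sign: it is the top view of [t] turned by a quarter turn one way or the
    other, and the orientation fixes which ([horizontal_normal]).  So [n1] and
    the Frenet normal [n] have the same top view ([unit_normal_horizontal]),
    and they differ by a multiple [w] of [b], where [w] is the z coordinate of
    [n - n1].

    Differentiating <n1, t> = 0 with n1' = mu t gives mu = - kappa, that is
    n1' = - kappa t ([rotation_minimizing_derivative]).  Subtracting this from
    the Frenet equation n' = - kappa t + tau b ([frenet_normal]) leaves
    w' = tau.  The fundamental theorem of calculus turns this into
    w(s) = w(s0) + int_{s0}^{s} tau, which is the formula for [n1] with
    tau0 = w(s0).  The equations of the RM frame follow: t' = kappa n =
    kappa n1 + kappa w b, and n1' = - kappa t.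

    Two points need care.  The interval may contain its end points, where the
    derivative is one-sided, so the calculus used here is developed for
    derivatives relative to a set, up to uniqueness ([is_derive_on_unique]) and
    the fundamental theorem ([is_RInt_derive_on]).  And [torsion] is only
    specified by the Frenet equation, so one has to prove both that this
    equation can be solved, in [frenet_normal], and that its solution is
    continuous, in [continuous_on_torsion]. *)

(** * Derivatives relative to a set *)

Lemma within_self_proper (I : R -> Prop) (s : R) :
  I s -> ProperFilter (within I (locally s)).
Proof.
  intros Is; split.
  - intros P HP.
    exists s; exact (locally_singleton _ _ HP Is).
  - apply within_filter; typeclasses eauto.
Qed.

Lemma is_filter_lim_within (I : R -> Prop) (s : R) :
  is_filter_lim (within I (locally s)) s.
Proof.
  intros P HP; refine (filter_imp _ _ _ HP); intros y Py _; exact Py.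
Qed.

Lemma is_derive_on_continuous {V : NormedModule R_AbsRing}
    (I : R -> Prop) (f : R -> V) (s : R) (l : V) :
  is_derive_on I f s l ->
  filterlim f (within I (locally s)) (locally (f s)).
Proof.
  intros Df.
  apply filterdiff_continuous_aux.
  - eexists; exact Df.
  - apply is_filter_lim_within.
Qed.

Lemma ex_derive_on_continuous_on {V : NormedModule R_AbsRing}
    (I : R -> Prop) (f : R -> V) :
  (forall s, I s -> ex_derive_on I f s) -> continuous_on I f.
Proof.
  intros Df s Is.
  destruct (Df s Is) as [l Dl].
  exact (is_derive_on_continuous I f s l Dl).
Qed.

(** The outer function is differentiated in the usual sense.  This is enough to
    get the rules for sums, products, inverses and square roots from the
    two-sided ones, with a pair as the inner function for sums and products. *)
Lemma is_derive_on_comp {V W : NormedModule R_AbsRing}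
    (I : R -> Prop) (f : R -> V) (g : V -> W) (lg : V -> W) (s : R) (l : V) :
  I s -> is_derive_on I f s l -> filterdiff g (locally (f s)) lg ->
  is_derive_on I (fun x => g (f x)) s (lg l).
Proof.
  intros Is Df Dg.
  pose proof (within_self_proper I s Is) as PF.
  assert (D : filterdiff (fun x => g (f x)) (within I (locally s))
                (fun h : R => lg (scal h l))).
  { apply (filterdiff_comp f g (fun h : R => scal h l) lg Df).
    refine (filterdiff_locally g (f s) lg _ Dg).
    exact (is_derive_on_continuous I f s l Df). }
  apply (filterdiff_ext_lin _ _ _ D).
  intros h; exact (linear_scal lg (proj1 Dg) h l).
Qed.

Lemma is_derive_on_ext {V : NormedModule R_AbsRing}
    (I : R -> Prop) (f g : R -> V) (s : R) (l : V) :
  I s -> (forall x, I x -> f x = g x) ->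
  is_derive_on I f s l -> is_derive_on I g s l.
Proof.
  intros Is Heq Df.
  pose proof (within_self_proper I s Is) as PF.
  apply (filterdiff_ext_loc f g); [| | exact Df].
  - apply (filter_forall (F := locally s)); exact Heq.
  - intros x Hx; apply Heq.
    replace x with s; [exact Is|].
    apply (is_filter_lim_unique (F := within I (locally s)));
      [apply is_filter_lim_within | exact Hx].
Qed.

Lemma is_derive_on_const {V : NormedModule R_AbsRing}
    (I : R -> Prop) (v : V) (s : R) : is_derive_on I (fun _ => v) s zero.
Proof.
  apply (filterdiff_ext_lin _ (fun _ => zero)).
  - apply filterdiff_const.
  - intros h; symmetry; exact (scal_zero_r h).
Qed.

Lemma is_derive_on_pair {V W : NormedModule R_AbsRing}
    (I : R -> Prop) (f : R -> V) (g : R -> W) (s : R) (l : V) (m : W) :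
  is_derive_on I f s l -> is_derive_on I g s m ->
  is_derive_on I (V := prod_NormedModule R_AbsRing V W)
    (fun x => (f x, g x)) s (l, m).
Proof.
  intros Df Dg.
  apply (filterdiff_comp_2 (W := prod_NormedModule R_AbsRing V W)
           f g pair _ _ pair Df Dg).
  apply (filterdiff_ext (fun t : prod_NormedModule R_AbsRing V W => t));
    [intros [? ?]; reflexivity |].
  apply (filterdiff_ext_lin _ (fun t : prod_NormedModule R_AbsRing V W => t));
    [| intros [? ?]; reflexivity].
  apply filterdiff_id.
Qed.

Lemma is_derive_on_scal {V : NormedModule R_AbsRing}
    (I : R -> Prop) (f : R -> R) (g : R -> V) (s l : R) (m : V) :
  I s -> is_derive_on I f s l -> is_derive_on I g s m ->
  is_derive_on I (fun x => scal (f x) (g x)) s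
    (plus (scal l (g s)) (scal (f s) m)).
Proof.
  intros Is Df Dg.
  refine (is_derive_on_comp (V := prod_NormedModule R_AbsRing R_NormedModule V)
    I (fun x => (f x, g x)) (fun t => scal (fst t) (snd t))
    (fun t => plus (scal (fst t) (g s)) (scal (f s) (snd t)))
    s (l, m) Is (is_derive_on_pair I f g s l m Df Dg) _).
  refine (filterdiff_scal (f s, g s) (fun P HP => HP) _).
  exact Rmult_comm.
Qed.

Lemma is_derive_on_plus {V : NormedModule R_AbsRing}
    (I : R -> Prop) (f g : R -> V) (s : R) (l m : V) :
  I s -> is_derive_on I f s l -> is_derive_on I g s m ->
  is_derive_on I (fun x => plus (f x) (g x)) s (plus l m).
Proof.
  intros Is Df Dg.
  exact (is_derive_on_comp (V := prod_NormedModule R_AbsRing V V)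
    I _ (fun t => plus (fst t) (snd t)) (fun t => plus (fst t) (snd t))
    s (l, m) Is (is_derive_on_pair I f g s l m Df Dg) (filterdiff_plus _)).
Qed.

(** * Uniqueness and the fundamental theorem on an interval *)

Lemma nondegenerate_interval_near (I : R -> Prop) (s : R) (d : posreal) :
  nondegenerate_interval I -> I s ->
  exists y, I y /\ y <> s /\ Rabs (y - s) < d.
Proof.
  intros [Hconv [p [q [Ip [Iq Hpq]]]]] Is.
  pose proof (cond_pos d) as Hd.
  destruct (Rlt_le_dec s q) as [Hsq | Hqs].
  - exists (Rmin q (s + d / 2)).
    assert (Hm : s < Rmin q (s + d / 2) <= q /\ Rmin q (s + d / 2) <= s + d / 2).
    { unfold Rmin; destruct (Rle_dec q (s + d / 2)); lra. }
    split; [| split].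
    + apply (Hconv s _ q Is Iq); lra.
    + lra.
    + rewrite Rabs_pos_eq; lra.
  - exists (Rmax p (s - d / 2)).
    assert (Hm : p <= Rmax p (s - d / 2) < s /\ s - d / 2 <= Rmax p (s - d / 2)).
    { unfold Rmax; destruct (Rle_dec p (s - d / 2)); lra. }
    split; [| split].
    + apply (Hconv p _ s Ip Is); lra.
    + lra.
    + rewrite Rabs_left; lra.
Qed.

(** A difference of two derivatives is bounded by every positive number because
    [I] has points other than [s] arbitrarily close to [s]; this is where
    nondegeneracy enters. *)
Lemma is_derive_on_unique {V : NormedModule R_AbsRing}
    (I : R -> Prop) (f : R -> V) (s : R) (l m : V) :
  nondegenerate_interval I -> I s ->
  is_derive_on I f s l -> is_derive_on I f s m -> l = m.
Proof.
  intros HI Is Dl Dm.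
  pose proof (within_self_proper I s Is) as PF.
  assert (D := filterdiff_minus_fct f f _ _ Dl Dm).
  apply proj2 in D; specialize (D s (is_filter_lim_within I s)).
  assert (Hsmall : forall eps : posreal, norm (minus l m) <= eps).
  { intros eps.
    destruct (D eps) as [d Hd].
    destruct (nondegenerate_interval_near I s d HI Is) as [y [Iy [Hys Hyd]]].
    specialize (Hd y Hyd Iy); cbv beta in Hd.
    assert (Hpos : 0 < Rabs (y - s)) by (apply Rabs_pos_lt; lra).
    assert (E : minus (minus (minus (f y) (f y)) (minus (f s) (f s)))
                  (minus (scal (minus y s) l) (scal (minus y s) m))
                = opp (scal (y - s) (minus l m))).
    { rewrite !minus_eq_zero. unfold minus at 1.
      rewrite plus_zero_l; apply f_equal; symmetry.
      exact (scal_minus_distr_l (y - s) l m). }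
    assert (Hd' : norm (scal (y - s) (minus l m)) <= eps * Rabs (y - s)).
    { refine (Rle_trans _ _ _ (Req_le _ _ _) Hd).
      refine (eq_trans (eq_sym (norm_opp _)) _).
      apply f_equal; exact (eq_sym E). }
    assert (N : norm (minus l m)
                <= / Rabs (y - s) * norm (scal (y - s) (minus l m))).
    { rewrite <- Rabs_inv.
      refine (Rle_trans _ _ _ (Req_le _ _ _)
                (norm_scal (/ (y - s)) (scal (y - s) (minus l m)))).
      apply f_equal.
      refine (eq_trans _ (eq_sym (scal_assoc (/ (y - s)) (y - s) (minus l m)))).
      change (mult (/ (y - s)) (y - s)) with (/ (y - s) * (y - s)).
      rewrite Rinv_l by lra; symmetry; exact (scal_one (minus l m)). }
    refine (Rle_trans _ _ _ N _).
    apply (Rmult_le_reg_l (Rabs (y - s))); [exact Hpos |].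
    rewrite <- Rmult_assoc, Rinv_r by lra; lra. }
  assert (Hz : norm (minus l m) = 0).
  { apply Rle_antisym; [| apply norm_ge_0].
    apply le_epsilon; intros eps Heps.
    specialize (Hsmall (mkposreal eps Heps)); simpl in Hsmall; lra. }
  apply norm_eq_zero in Hz.
  apply (plus_reg_r (opp m)).
  exact (eq_trans Hz (eq_sym (plus_opp_r m))).
Qed.

Lemma Derive_on_correct {V : NormedModule R_AbsRing}
    (I : R -> Prop) (f : R -> V) (s : R) :
  ex_derive_on I f s -> is_derive_on I f s (Derive_on I f s).
Proof.
  exact (epsilon_spec (inhabits zero) (is_derive_on I f s)).
Qed.

Lemma is_derive_on_interior {V : NormedModule R_AbsRing}
    (I : R -> Prop) (f : R -> V) (s : R) (l : V) :
  locally s I -> is_derive_on I f s l -> is_derive f s l.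
Proof.
  intros Hloc [Hlin Hdom]; split; [exact Hlin |].
  intros x Hx eps.
  assert (Hx' : is_filter_lim (within I (locally s)) x).
  { intros P HP; refine (filter_imp _ _ _ (Hx P HP)); intros y Py _; exact Py. }
  generalize (filter_and _ _ Hloc (Hdom x Hx' eps)).
  apply filter_imp; intros y [Iy Hy]; exact (Hy Iy).
Qed.

Lemma continuous_on_comp_2 {T U V W : UniformSpace} (D : T -> Prop)
    (f : T -> U) (g : T -> V) (h : U -> V -> W) :
  (forall x, D x -> filterlim (fun p : U * V => h (fst p) (snd p))
     (filter_prod (locally (f x)) (locally (g x))) (locally (h (f x) (g x)))) ->
  continuous_on D f -> continuous_on D g ->
  continuous_on D (fun x => h (f x) (g x)).
Proof.
  intros Hh Cf Cg x Dx.
  exact (filterlim_comp_2 _ _ h (Cf x Dx) (Cg x Dx) (Hh x Dx)).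
Qed.

Lemma continuous_on_comp {T U W : UniformSpace} (D : T -> Prop)
    (f : T -> U) (h : U -> W) :
  (forall x, D x -> continuous h (f x)) ->
  continuous_on D f -> continuous_on D (fun x => h (f x)).
Proof.
  intros Hh Cf x Dx.
  exact (filterlim_comp _ _ _ _ _ _ _ _ (Cf x Dx) (Hh x Dx)).
Qed.

Lemma continuous_on_Rplus (D : R -> Prop) (f g : R -> R) :
  continuous_on D f -> continuous_on D g -> continuous_on D (fun x => f x + g x).
Proof.
  apply (continuous_on_comp_2 D f g Rplus).
  intros x _; exact (filterlim_plus (f x) (g x)).
Qed.

Lemma continuous_on_Rmult (D : R -> Prop) (f g : R -> R) :
  continuous_on D f -> continuous_on D g -> continuous_on D (fun x => f x * g x).
Proof.
  apply (continuous_on_comp_2 D f g Rmult).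
  intros x _; exact (filterlim_mult (f x) (g x)).
Qed.

(** Composing with the retraction of the line onto [[a, b]] trades continuity
    relative to [I] for continuity on the whole line. *)
Lemma continuous_on_clamp {U : UniformSpace} (I : R -> Prop) (f : R -> U) (a b : R) :
  a <= b -> (forall x, a <= x <= b -> I x) -> continuous_on I f ->
  forall x, continuous (fun y => f (Rmax a (Rmin b y))) x.
Proof.
  intros Hab Hsub Cf x.
  assert (Hc : forall y, a <= Rmax a (Rmin b y) <= b).
  { intros y; unfold Rmax, Rmin; repeat destruct (Rle_dec _ _); lra. }
  refine (filterlim_comp _ _ _ (fun y => Rmax a (Rmin b y)) f _
            (within I (locally (Rmax a (Rmin b x)))) _ _
            (Cf _ (Hsub _ (Hc x)))).
  intros P [d Hd]; exists d; intros y Hy.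
  apply Hd; [| exact (Hsub _ (Hc y))].
  refine (Rle_lt_trans _ _ _ _ Hy).
  unfold minus, plus, opp, abs; simpl.
  unfold Rmax, Rmin; repeat destruct (Rle_dec _ _);
    unfold Rabs; repeat destruct (Rcase_abs _); lra.
Qed.

(** At the end points of [[a, b]] the function [f] need not have a two-sided
    derivative, so a primitive defined on the line is not at hand.  Instead [f]
    and [df] are extended by constants outside [[a, b]]: the integral of the
    extended [df] is differentiable everywhere, and its difference with the
    extended [f] is continuous on [[a, b]] with derivative zero inside, hence
    takes the same value at both ends by the mean value theorem. *)
Lemma is_RInt_derive_on (I : R -> Prop) (f df : R -> R) (a b : R) :
  (forall x y z, I x -> I z -> x <= y <= z -> I y) ->
  (forall s, I s -> is_derive_on I f s (df s)) -> continuous_on I df ->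
  I a -> I b -> is_RInt df a b (f b - f a).
Proof.
  intros Hconv Df Cdf.
  assert (main : forall a b, a <= b -> I a -> I b ->
            is_RInt df a b (f b - f a)).
  { clear a b; intros a b Hab Ia Ib.
    set (c := fun y => Rmax a (Rmin b y)).
    assert (Hsub : forall x, a <= x <= b -> I x)
      by (intros x Hx; exact (Hconv a x b Ia Ib Hx)).
    assert (Hcid : forall x, a <= x <= b -> c x = x).
    { intros x Hx; unfold c; rewrite Rmin_right, Rmax_right; lra. }
    assert (Cg : forall x, continuous (fun y => df (c y)) x)
      by exact (continuous_on_clamp I df a b Hab Hsub Cdf).
    assert (Cf : forall x, continuous (fun y => f (c y)) x).
    { apply (continuous_on_clamp I f a b Hab Hsub).
      apply (ex_derive_on_continuous_on (V := R_NormedModule) I f); intros s Is.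
      eexists; exact (Df s Is). }
    assert (Hint : forall y, ex_RInt (fun y => df (c y)) a y)
      by (intros y; apply (ex_RInt_continuous (V := R_CompleteNormedModule));
          intros; apply Cg).
    assert (DG : forall x, is_derive (RInt (fun y => df (c y)) a) x (df (c x))).
    { intros x; apply (is_derive_RInt (fun y => df (c y)) _ a); [| apply Cg].
      apply filter_forall; intros y; exact (RInt_correct _ _ _ (Hint y)). }
    destruct (MVT_gen (fun x => minus (f (c x)) (RInt (fun y => df (c y)) a x))
                a b (fun _ => 0)) as [e [_ He]].
    - rewrite Rmin_left, Rmax_right by exact Hab; intros x Hx.
      replace 0 with (minus (df x) (df (c x)))
        by (rewrite Hcid by lra; apply Rplus_opp_r).
      apply (is_derive_minus (V := R_NormedModule) (fun x => f (c x))); [| apply DG].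
      apply (is_derive_ext_loc f).
      + apply (locally_interval _ x a b); simpl; try lra.
        intros y Hy1 Hy2; rewrite Hcid; [reflexivity | simpl in *; lra].
      + apply (is_derive_on_interior I).
        * apply (locally_interval _ x a b); simpl; try lra.
          intros y Hy1 Hy2; apply Hsub; simpl in *; lra.
        * apply Df, Hsub; lra.
    - intros x _; apply continuity_pt_filterlim.
      apply (continuous_minus (V := R_NormedModule) (fun x => f (c x))); [apply Cf |].
      apply (ex_derive_continuous (V := R_NormedModule)).
      eexists; apply DG.
    - rewrite !Hcid, RInt_point in He by lra.
      unfold minus, plus, opp, zero in He; simpl in He.
      replace (f b - f a) with (RInt (fun y => df (c y)) a b) by lra.
      apply (is_RInt_ext (fun y => df (c y))).
      + rewrite Rmin_left, Rmax_right by exact Hab; intros x Hx.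
        rewrite Hcid; [reflexivity | lra].
      + exact (RInt_correct _ _ _ (Hint b)). }
  intros Ia Ib.
  destruct (Rle_lt_dec a b) as [Hab | Hab]; [exact (main a b Hab Ia Ib) |].
  replace (f b - f a) with (opp (f a - f b)) by (unfold opp; simpl; ring).
  apply (is_RInt_swap (V := R_NormedModule)), main; [lra | exact Ib | exact Ia].
Qed.

(** * Calculus for coordinates and for the degenerate inner product *)

Lemma is_derive_on_Rmult (I : R -> Prop) (f g : R -> R) (s l m : R) :
  I s -> is_derive_on I f s l -> is_derive_on I g s m ->
  is_derive_on I (fun x => f x * g x) s (l * g s + f s * m).
Proof. exact (is_derive_on_scal I f g s l m). Qed.

Lemma is_derive_on_Rplus (I : R -> Prop) (f g : R -> R) (s l m : R) :
  I s -> is_derive_on I f s l -> is_derive_on I g s m ->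
  is_derive_on I (fun x => f x + g x) s (l + m).
Proof. exact (is_derive_on_plus I f g s l m). Qed.

Lemma is_derive_on_comp_R (I : R -> Prop) (f g : R -> R) (s l m : R) :
  I s -> is_derive_on I f s l -> is_derive g (f s) m ->
  is_derive_on I (fun x => g (f x)) s (l * m).
Proof. exact (is_derive_on_comp I f g (fun h => scal h m) s l). Qed.

Lemma is_derive_on_linear {V W : NormedModule R_AbsRing} (I : R -> Prop)
    (L : V -> W) (f : R -> V) (s : R) (l : V) :
  is_linear L -> I s -> is_derive_on I f s l ->
  is_derive_on I (fun x => L (f x)) s (L l).
Proof.
  intros HL Is Df.
  exact (is_derive_on_comp I f L L s l Is Df (filterdiff_linear L HL)).
Qed.

Lemma is_linear_xc : is_linear xc.
Proof. exact (is_linear_comp _ _ is_linear_fst is_linear_fst). Qed.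

Lemma is_linear_yc : is_linear yc.
Proof. exact (is_linear_comp _ _ is_linear_fst is_linear_snd). Qed.

Lemma is_linear_zc : is_linear zc.
Proof. exact is_linear_snd. Qed.

Lemma continuous_on_linear {V : NormedModule R_AbsRing} (D : R -> Prop)
    (L : V -> R) (f : R -> V) :
  is_linear L -> continuous_on D f -> continuous_on D (fun x => L (f x)).
Proof.
  intros HL; apply (continuous_on_comp D f L).
  intros x _; apply (filterdiff_continuous (V := R_NormedModule)).
  exists L; exact (filterdiff_linear L HL).
Qed.

Lemma is_derive_on_inner_z (I : R -> Prop) (u v : R -> vec) (s : R) (l m : vec) :
  I s -> is_derive_on I u s l -> is_derive_on I v s m ->
  is_derive_on I (fun x => inner_z (u x) (v x)) s
    (inner_z l (v s) + inner_z (u s) m).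
Proof.
  intros Is Du Dv.
  replace (inner_z l (v s) + inner_z (u s) m)
    with ((xc l * xc (v s) + xc (u s) * xc m)
          + (yc l * yc (v s) + yc (u s) * yc m)) by (unfold inner_z; ring).
  apply (is_derive_on_Rplus I (fun x => xc (u x) * xc (v x)));
    [exact Is | |]; apply is_derive_on_Rmult; try exact Is;
    apply is_derive_on_linear; auto using is_linear_xc, is_linear_yc.
Qed.

Lemma continuous_on_inner_z (D : R -> Prop) (u v : R -> vec) :
  continuous_on D u -> continuous_on D v ->
  continuous_on D (fun x => inner_z (u x) (v x)).
Proof.
  intros Cu Cv.
  apply (continuous_on_Rplus D (fun x => xc (u x) * xc (v x)));
    apply continuous_on_Rmult; apply continuous_on_linear;
    auto using is_linear_xc, is_linear_yc.
Qed.

Lemma xc_plus (u v : vec) : xc (plus u v) = xc u + xc v.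
Proof. reflexivity. Qed.

Lemma xc_scal (k : R) (u : vec) : xc (scal k u) = k * xc u.
Proof. reflexivity. Qed.

Lemma yc_plus (u v : vec) : yc (plus u v) = yc u + yc v.
Proof. reflexivity. Qed.

Lemma yc_scal (k : R) (u : vec) : yc (scal k u) = k * yc u.
Proof. reflexivity. Qed.

Lemma zc_plus (u v : vec) : zc (plus u v) = zc u + zc v.
Proof. reflexivity. Qed.

Lemma zc_scal (k : R) (u : vec) : zc (scal k u) = k * zc u.
Proof. reflexivity. Qed.

Lemma xc_opp (u : vec) : xc (opp u) = - xc u.
Proof. reflexivity. Qed.

Lemma yc_opp (u : vec) : yc (opp u) = - yc u.
Proof. reflexivity. Qed.

Lemma zc_opp (u : vec) : zc (opp u) = - zc u.
Proof. reflexivity. Qed.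

Lemma vec_ext (u v : vec) : xc u = xc v -> yc u = yc v -> zc u = zc v -> u = v.
Proof.
  destruct u as [[? ?] ?], v as [[? ?] ?]; unfold xc, yc, zc; simpl.
  intros -> -> ->; reflexivity.
Qed.

(** * Orthonormal pairs in the top view *)

Lemma det3_binormal (u v : vec) (s : R) :
  det3 u v (binormal s) = xc u * yc v - yc u * xc v.
Proof. unfold det3, binormal, xc, yc, zc; simpl; ring. Qed.

(** In the top view [v] is a unit vector orthogonal to the unit vector [u],
    hence [u] turned by a quarter turn.  The direction of the turn is the sign
    of the determinant, so this sign determines [xc v] and [yc v]. *)
Lemma horizontal_normal (u v : vec) (s : R) :
  inner_z u u = 1 -> inner_z v v = 1 -> inner_z v u = 0 ->
  let e := sign (det3 u v (binormal s)) in
  e * e = 1 /\ xc v = - e * yc u /\ yc v = e * xc u.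
Proof.
  intros Huu Hvv Hvu; cbv zeta; rewrite det3_binormal.
  set (d := xc u * yc v - yc u * xc v); unfold inner_z in *.
  (* Lagrange's identity in the plane. *)
  assert (Hd : d * d = 1).
  { replace (d * d) with ((xc u * xc u + yc u * yc u) * (xc v * xc v + yc v * yc v)
      - (xc v * xc u + yc v * yc u) * (xc v * xc u + yc v * yc u))
      by (unfold d; ring).
    rewrite Huu, Hvv, Hvu; ring. }
  assert (He : sign d = d).
  { destruct (Rtotal_order d 0) as [Hlt | [Heq | Hgt]].
    - rewrite sign_eq_m1 by exact Hlt; nra.
    - rewrite Heq in Hd; lra.
    - rewrite sign_eq_1 by exact Hgt; nra. }
  rewrite He; repeat split; [exact Hd | |].
  - replace (xc v) with ((xc u * xc u + yc u * yc u) * xc v)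
      by (rewrite Huu; ring).
    replace (- d * yc u)
      with ((xc u * xc u + yc u * yc u) * xc v - xc u * (xc v * xc u + yc v * yc u))
      by (unfold d; ring).
    rewrite Hvu; ring.
  - replace (yc v) with ((xc u * xc u + yc u * yc u) * yc v)
      by (rewrite Huu; ring).
    replace (d * xc u)
      with ((xc u * xc u + yc u * yc u) * yc v - yc u * (xc v * xc u + yc v * yc u))
      by (unfold d; ring).
    rewrite Hvu; ring.
Qed.

(** In the plane, being orthogonal to [v] amounts to being parallel to [u]. *)
Lemma horizontal_basis (u v p : vec) :
  inner_z u u = 1 -> inner_z v v = 1 -> inner_z v u = 0 -> inner_z p v = 0 ->
  xc p = inner_z p u * xc u /\ yc p = inner_z p u * yc u.
Proof.
  intros Huu Hvv Hvu Hpv.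
  destruct (horizontal_normal u v 0 Huu Hvv Hvu) as [He [Hx Hy]].
  set (e := sign _) in *; clearbody e; unfold inner_z in *.
  assert (Hpar : xc u * yc p - yc u * xc p = 0).
  { replace (xc u * yc p - yc u * xc p)
      with (e * (xc p * (- e * yc u) + yc p * (e * xc u))
            + (1 - e * e) * (xc u * yc p - yc u * xc p)) by ring.
    rewrite <- Hx, <- Hy, Hpv, He; ring. }
  split.
  - replace (xc p) with (xc p * (xc u * xc u + yc u * yc u)) at 1
      by (rewrite Huu; ring).
    replace (xc p * (xc u * xc u + yc u * yc u))
      with ((xc p * xc u + yc p * yc u) * xc u
            - yc u * (xc u * yc p - yc u * xc p)) by ring.
    rewrite Hpar; ring.
  - replace (yc p) with (yc p * (xc u * xc u + yc u * yc u)) at 1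
      by (rewrite Huu; ring).
    replace (yc p * (xc u * xc u + yc u * yc u))
      with ((xc p * xc u + yc p * yc u) * yc u
            + xc u * (xc u * yc p - yc u * xc p)) by ring.
    rewrite Hpar; ring.
Qed.

Lemma inner_z_ge_0 (u : vec) : 0 <= inner_z u u.
Proof. unfold inner_z; nra. Qed.

Lemma norm_z_sqr (u : vec) : norm_z u * norm_z u = inner_z u u.
Proof. apply sqrt_sqrt, inner_z_ge_0. Qed.

Lemma inner_z_comm (u v : vec) : inner_z u v = inner_z v u.
Proof. unfold inner_z; ring. Qed.

Lemma inner_z_scal_l (k : R) (u v : vec) :
  inner_z (scal k u) v = k * inner_z u v.
Proof.
  unfold inner_z; rewrite xc_scal, yc_scal; ring.
Qed.

(** Applied to the constant inner products of a frame, this gives the relations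
    between the coefficients of its derivative. *)
Lemma inner_z_derive_const (I : R -> Prop) (u v : R -> vec) (k s : R) (l m : vec) :
  nondegenerate_interval I -> I s ->
  (forall x, I x -> inner_z (u x) (v x) = k) ->
  is_derive_on I u s l -> is_derive_on I v s m ->
  inner_z l (v s) + inner_z (u s) m = 0.
Proof.
  intros HI Is Hk Du Dv.
  apply (is_derive_on_unique (V := R_NormedModule) I (fun _ => k) s);
    [exact HI | exact Is | | exact (is_derive_on_const (V := R_NormedModule) I k s)].
  apply (is_derive_on_ext I (fun x => inner_z (u x) (v x)));
    [exact Is | exact Hk |].
  apply is_derive_on_inner_z; assumption.
Qed.

(** * The Frenet frame *)

Lemma tangent_derivatives (I : R -> Prop) (alpha : R -> vec) :
  C_on 3 I alpha ->
  let t := tangent I alpha in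
  (forall s, I s -> is_derive_on I t s (Derive_on I t s)) /\
  (forall s, I s ->
     is_derive_on I (Derive_on I t) s (Derive_on I (Derive_on I t) s)) /\
  continuous_on I (Derive_on I (Derive_on I t)).
Proof.
  intros [_ [D1 [D2 C3]]]; split; [| split].
  - intros s Is; apply Derive_on_correct, D1, Is.
  - intros s Is; apply Derive_on_correct, D2, Is.
  - exact C3.
Qed.

Lemma tangent_unit (I : R -> Prop) (alpha : R -> vec) (s : R) :
  unit_speed I alpha -> I s -> inner_z (tangent I alpha s) (tangent I alpha s) = 1.
Proof.
  intros Hu Is; rewrite <- norm_z_sqr.
  change (tangent I alpha s) with (Derive_on I alpha s).
  rewrite (Hu s Is); ring.
Qed.

Lemma inner_z_gt_0 (u v : vec) : xc u * yc v - xc v * yc u <> 0 -> 0 < inner_z v v.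
Proof.
  intros Hdet.
  destruct (Rle_lt_or_eq_dec _ _ (inner_z_ge_0 v)) as [H | H]; [exact H |].
  unfold inner_z in H; exfalso; apply Hdet.
  replace (xc v) with 0 by nra; replace (yc v) with 0 by nra; ring.
Qed.

Lemma curvature_gt_0 (I : R -> Prop) (alpha : R -> vec) (s : R) :
  admissible I alpha -> I s -> 0 < curvature I alpha s.
Proof.
  intros Ha Is; destruct (Ha s Is) as [_ Hdet].
  exact (sqrt_lt_R0 _ (inner_z_gt_0 _ _ Hdet)).
Qed.

Lemma tangent_derivative_orthogonal (I : R -> Prop) (alpha : R -> vec) (s : R) :
  nondegenerate_interval I -> C_on 3 I alpha -> unit_speed I alpha -> I s ->
  inner_z (Derive_on I (tangent I alpha) s) (tangent I alpha s) = 0.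
Proof.
  intros HI HC Hu Is.
  destruct (tangent_derivatives I alpha HC) as [D1 _].
  pose proof (inner_z_derive_const I _ _ 1 s _ _ HI Is
    (fun x => tangent_unit I alpha x Hu) (D1 s Is) (D1 s Is)) as H.
  rewrite (inner_z_comm (tangent I alpha s)) in H; lra.
Qed.

Lemma normal_orthonormal (I : R -> Prop) (alpha : R -> vec) (s : R) :
  nondegenerate_interval I -> C_on 3 I alpha -> unit_speed I alpha ->
  admissible I alpha -> I s ->
  inner_z (normal I alpha s) (tangent I alpha s) = 0 /\
  inner_z (normal I alpha s) (normal I alpha s) = 1 /\
  inner_z (Derive_on I (tangent I alpha) s) (normal I alpha s)
    = curvature I alpha s.
Proof.
  intros HI HC Hu Ha Is.
  pose proof (curvature_gt_0 I alpha s Ha Is) as Hk.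
  assert (Hsqr : inner_z (Derive_on I (tangent I alpha) s)
                   (Derive_on I (tangent I alpha) s)
                 = curvature I alpha s * curvature I alpha s)
    by (symmetry; apply norm_z_sqr).
  assert (Hcn : inner_z (Derive_on I (tangent I alpha) s) (normal I alpha s)
                = curvature I alpha s).
  { unfold normal; rewrite inner_z_comm, inner_z_scal_l, Hsqr; field; lra. }
  split; [| split; [| exact Hcn]]; unfold normal at 1; rewrite inner_z_scal_l.
  - rewrite (tangent_derivative_orthogonal I alpha s HI HC Hu Is); ring.
  - rewrite Hcn; field; lra.
Qed.

(** The square root is differentiable here because [curvature_gt_0] keeps its
    argument away from zero. *)
Lemma is_derive_on_curvature (I : R -> Prop) (alpha : R -> vec) (s : R) :
  C_on 3 I alpha -> admissible I alpha -> I s ->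
  let t1 := Derive_on I (tangent I alpha) in
  is_derive_on I (curvature I alpha) s
    (inner_z (t1 s) (Derive_on I t1 s) * / curvature I alpha s).
Proof.
  intros HC Ha Is t1.
  pose proof (curvature_gt_0 I alpha s Ha Is) as Hk.
  destruct (tangent_derivatives I alpha HC) as [_ [D2 _]].
  assert (Hpos : 0 < inner_z (t1 s) (t1 s))
    by (unfold t1; rewrite <- norm_z_sqr; apply Rmult_lt_0_compat; exact Hk).
  replace (inner_z (t1 s) (Derive_on I t1 s) * / curvature I alpha s)
    with ((inner_z (Derive_on I t1 s) (t1 s) + inner_z (t1 s) (Derive_on I t1 s))
          * (/ (2 * sqrt (inner_z (t1 s) (t1 s))))).
  2:{ change (sqrt (inner_z (t1 s) (t1 s))) with (curvature I alpha s).
      rewrite (inner_z_comm (Derive_on I t1 s)); field; lra. }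
  apply (is_derive_on_comp_R I (fun x => inner_z (t1 x) (t1 x)) sqrt);
    [exact Is | | exact (filterdiff_sqrt _ Hpos)].
  apply is_derive_on_inner_z; [exact Is | exact (D2 s Is) | exact (D2 s Is)].
Qed.

Lemma is_derive_on_inv_curvature (I : R -> Prop) (alpha : R -> vec) (s : R) :
  C_on 3 I alpha -> admissible I alpha -> I s ->
  let t1 := Derive_on I (tangent I alpha) in
  is_derive_on I (fun x => / curvature I alpha x) s
    (- (inner_z (t1 s) (Derive_on I t1 s) * / curvature I alpha s)
     * (/ curvature I alpha s * / curvature I alpha s)).
Proof.
  intros HC Ha Is t1.
  pose proof (curvature_gt_0 I alpha s Ha Is) as Hk.
  replace (- (inner_z (t1 s) (Derive_on I t1 s) * / curvature I alpha s)
     * (/ curvature I alpha s * / curvature I alpha s))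
    with (inner_z (t1 s) (Derive_on I t1 s) * / curvature I alpha s
          * (- 1 / curvature I alpha s ^ 2)) by (field; lra).
  apply (is_derive_on_comp_R I (curvature I alpha) Rinv);
    [exact Is | apply is_derive_on_curvature; assumption |].
  apply (is_derive_inv (fun x => x)); [apply (is_derive_id (K := R_AbsRing)) | lra].
Qed.

(** Only differentiability and the form of the z coordinate matter in this
    expression; its top view is simplified in [frenet_normal]. *)
Lemma is_derive_on_normal (I : R -> Prop) (alpha : R -> vec) (s : R) :
  C_on 3 I alpha -> admissible I alpha -> I s ->
  let t1 := Derive_on I (tangent I alpha) in
  is_derive_on I (normal I alpha) s
    (plus (scal (- (inner_z (t1 s) (Derive_on I t1 s) * / curvature I alpha s)
                 * (/ curvature I alpha s * / curvature I alpha s)) (t1 s))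
       (scal (/ curvature I alpha s) (Derive_on I t1 s))).
Proof.
  intros HC Ha Is t1.
  destruct (tangent_derivatives I alpha HC) as [_ [D2 _]].
  apply (is_derive_on_scal I (fun x => / curvature I alpha x) t1);
    [exact Is | | exact (D2 s Is)].
  apply is_derive_on_inv_curvature; assumption.
Qed.

(** Differentiating <n, n> = 1 and <n, t> = 0 shows that n' is orthogonal to [n]
    and that <n', t> = - <n, t'> = - kappa.  So the top view of n' is
    that of - kappa t, and what is left is vertical: the equation that
    specifies [torsion] has a solution. *)
Lemma frenet_normal (I : R -> Prop) (alpha : R -> vec) (s : R) :
  nondegenerate_interval I -> C_on 3 I alpha -> unit_speed I alpha ->
  admissible I alpha -> I s ->
  is_derive_on I (normal I alpha) s
    (plus (scal (- curvature I alpha s) (tangent I alpha s))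
       (scal (torsion I alpha s) (binormal s))).
Proof.
  intros HI HC Hu Ha Is.
  destruct (tangent_derivatives I alpha HC) as [D1 _].
  assert (Dn : is_derive_on I (normal I alpha) s (Derive_on I (normal I alpha) s)).
  { apply Derive_on_correct; eexists; apply is_derive_on_normal; assumption. }
  destruct (normal_orthonormal I alpha s HI HC Hu Ha Is) as [Hnt [Hnn Hcn]].
  assert (Hdn : inner_z (Derive_on I (normal I alpha) s) (normal I alpha s) = 0).
  { pose proof (inner_z_derive_const I _ _ 1 s _ _ HI Is
      (fun x Ix => proj1 (proj2 (normal_orthonormal I alpha x HI HC Hu Ha Ix)))
      Dn Dn) as H.
    rewrite (inner_z_comm (normal I alpha s)) in H; lra. }
  assert (Hdt : inner_z (Derive_on I (normal I alpha) s) (tangent I alpha s)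
                = - curvature I alpha s).
  { pose proof (inner_z_derive_const I _ _ 0 s _ _ HI Is
      (fun x Ix => proj1 (normal_orthonormal I alpha x HI HC Hu Ha Ix))
      Dn (D1 s Is)) as H.
    rewrite (inner_z_comm (normal I alpha s)), Hcn in H; lra. }
  destruct (horizontal_basis _ _ _ (tangent_unit I alpha s Hu Is) Hnn Hnt Hdn)
    as [Hx Hy].
  assert (Htau : Derive_on I (normal I alpha) s =
    plus (scal (- curvature I alpha s) (tangent I alpha s))
       (scal (torsion I alpha s) (binormal s))).
  { apply (epsilon_spec (inhabits 0) (fun r : R =>
      Derive_on I (normal I alpha) s =
      plus (scal (- curvature I alpha s) (tangent I alpha s))
        (scal r (binormal s)))).
    exists (zc (Derive_on I (normal I alpha) s)
            + curvature I alpha s * zc (tangent I alpha s)).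
    rewrite Hdt in Hx, Hy.
    apply vec_ext.
    - rewrite Hx, xc_plus, !xc_scal; unfold binormal, xc; simpl; ring.
    - rewrite Hy, yc_plus, !yc_scal; unfold binormal, yc; simpl; ring.
    - rewrite zc_plus, !zc_scal; unfold binormal, zc; simpl; ring. }
  rewrite <- Htau; exact Dn.
Qed.

(** The z coordinate of the Frenet equation; it makes the continuity of
    [torsion] visible, the right-hand side being built from the coordinates of
    the first three derivatives of the curve. *)
Lemma torsion_eq (I : R -> Prop) (alpha : R -> vec) (s : R) :
  nondegenerate_interval I -> C_on 3 I alpha -> unit_speed I alpha ->
  admissible I alpha -> I s ->
  let t1 := Derive_on I (tangent I alpha) in
  torsion I alpha s =
  - (inner_z (t1 s) (Derive_on I t1 s) * / curvature I alpha s)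
     * (/ curvature I alpha s * / curvature I alpha s) * zc (t1 s)
  + / curvature I alpha s * zc (Derive_on I t1 s)
  + curvature I alpha s * zc (tangent I alpha s).
Proof.
  intros HI HC Hu Ha Is t1.
  pose proof (f_equal zc (is_derive_on_unique I _ s _ _ HI Is
    (frenet_normal I alpha s HI HC Hu Ha Is)
    (is_derive_on_normal I alpha s HC Ha Is))) as H.
  rewrite !zc_plus, !zc_scal in H; unfold binormal in H.
  change (zc (0, 0, 1)) with 1 in H; unfold t1; lra.
Qed.

Lemma continuous_on_torsion (I : R -> Prop) (alpha : R -> vec) :
  nondegenerate_interval I -> C_on 3 I alpha -> unit_speed I alpha ->
  admissible I alpha -> continuous_on I (torsion I alpha).
Proof.
  intros HI HC Hu Ha.
  destruct (tangent_derivatives I alpha HC) as [D1 [D2 C3]].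
  eapply continuous_on_ext.
  - intros s Is; symmetry; exact (torsion_eq I alpha s HI HC Hu Ha Is).
  - assert (C1 := ex_derive_on_continuous_on I (tangent I alpha)
      (fun s Is => ex_intro _ _ (D1 s Is))).
    assert (C2 := ex_derive_on_continuous_on I (Derive_on I (tangent I alpha))
      (fun s Is => ex_intro _ _ (D2 s Is))).
    assert (Ck : continuous_on I (curvature I alpha)).
    { apply (ex_derive_on_continuous_on (V := R_NormedModule)); intros s Is.
      eexists; exact (is_derive_on_curvature I alpha s HC Ha Is). }
    assert (Cik : continuous_on I (fun x => / curvature I alpha x)).
    { apply (ex_derive_on_continuous_on (V := R_NormedModule)); intros s Is.
      eexists; exact (is_derive_on_inv_curvature I alpha s HC Ha Is). }
    assert (Copp : continuous_on I (fun x =>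
      - (inner_z (Derive_on I (tangent I alpha) x)
           (Derive_on I (Derive_on I (tangent I alpha)) x)
         * / curvature I alpha x))).
    { apply (continuous_on_linear (V := R_NormedModule) I Ropp);
        [exact is_linear_opp |].
      apply continuous_on_Rmult; [apply continuous_on_inner_z |]; assumption. }
    repeat first [ assumption | apply continuous_on_Rplus
                 | apply continuous_on_Rmult
                 | apply continuous_on_linear; [exact is_linear_zc |] ].
Qed.

(** * Rotation minimizing fields *)

Lemma unit_normal_horizontal (I : R -> Prop) (alpha n1 : R -> vec) (s : R) :
  nondegenerate_interval I -> C_on 3 I alpha -> unit_speed I alpha ->
  admissible I alpha -> normal_field I alpha n1 -> unit_field I n1 ->
  frenet_oriented I alpha n1 -> I s ->
  xc (n1 s) = xc (normal I alpha s) /\ yc (n1 s) = yc (normal I alpha s).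
Proof.
  intros HI HC Hu Ha Hn1 Hun1 Hor Is.
  pose proof (tangent_unit I alpha s Hu Is) as Htt.
  destruct (normal_orthonormal I alpha s HI HC Hu Ha Is) as [Hnt [Hnn _]].
  destruct (horizontal_normal _ _ s Htt (Hun1 s Is) (Hn1 s Is)) as [_ [Hx Hy]].
  destruct (horizontal_normal _ _ s Htt Hnn Hnt) as [_ [Hnx Hny]].
  rewrite Hx, Hy, Hnx, Hny, (Hor s Is); split; reflexivity.
Qed.

(** Differentiating <n1, t> = 0 gives mu + <n1, t'> = 0, and <n1, t'> = <n, t'>
    = kappa since [n1] and [n] have the same top view. *)
Lemma rotation_minimizing_derivative (I : R -> Prop) (alpha n1 : R -> vec) (s : R) :
  nondegenerate_interval I -> C_on 3 I alpha -> unit_speed I alpha ->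
  admissible I alpha -> unit_field I n1 -> rotation_minimizing I alpha n1 ->
  frenet_oriented I alpha n1 -> I s ->
  is_derive_on I n1 s (scal (- curvature I alpha s) (tangent I alpha s)).
Proof.
  intros HI HC Hu Ha Hun1 [Hn1 [mu Dmu]] Hor Is.
  destruct (tangent_derivatives I alpha HC) as [D1 _].
  pose proof (inner_z_derive_const I _ _ 0 s _ _ HI Is Hn1 (Dmu s Is) (D1 s Is))
    as H.
  destruct (unit_normal_horizontal I alpha n1 s HI HC Hu Ha Hn1 Hun1 Hor Is)
    as [Hx Hy].
  destruct (normal_orthonormal I alpha s HI HC Hu Ha Is) as [_ [_ Hcn]].
  assert (E : inner_z (n1 s) (Derive_on I (tangent I alpha) s)
              = curvature I alpha s)
    by (rewrite <- Hcn; unfold inner_z; rewrite Hx, Hy; ring).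
  rewrite inner_z_scal_l, (tangent_unit I alpha s Hu Is), E in H.
  replace (- curvature I alpha s) with (mu s) by lra; exact (Dmu s Is).
Qed.

(** The tangential parts of n' and n1' are equal, so (n - n1)' = tau b. *)
Lemma is_RInt_torsion (I : R -> Prop) (alpha n1 : R -> vec) (s0 s : R) :
  nondegenerate_interval I -> C_on 3 I alpha -> unit_speed I alpha ->
  admissible I alpha -> unit_field I n1 -> rotation_minimizing I alpha n1 ->
  frenet_oriented I alpha n1 -> I s0 -> I s ->
  is_RInt (torsion I alpha) s0 s
    (zc (minus (normal I alpha s) (n1 s)) - zc (minus (normal I alpha s0) (n1 s0))).
Proof.
  intros HI HC Hu Ha Hun1 HRM Hor.
  apply (is_RInt_derive_on I (fun x => zc (minus (normal I alpha x) (n1 x)))).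
  - exact (proj1 HI).
  - intros x Ix.
    pose proof (is_derive_on_linear I zc _ x _ is_linear_zc Ix
      (is_derive_on_plus I _ _ x _ _ Ix
        (frenet_normal I alpha x HI HC Hu Ha Ix)
        (is_derive_on_linear I opp n1 x _ is_linear_opp Ix
          (rotation_minimizing_derivative I alpha n1 x HI HC Hu Ha Hun1 HRM Hor Ix))))
      as D.
    rewrite !zc_plus, zc_opp, !zc_scal in D; unfold binormal in D.
    change (zc (0, 0, 1)) with 1 in D.
    match type of D with is_derive_on _ _ _ ?d =>
      replace d with (torsion I alpha x) in D by ring end.
    exact D.
  - apply continuous_on_torsion; assumption.
Qed.

Theorem theorem4p2
  (I : R -> Prop) (alpha : R -> vec) (s0 : R) (n1 : R -> vec)
  (hI : nondegenerate_interval I)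
  (halpha : C_on 3 I alpha)
  (hspeed : unit_speed I alpha)
  (hadm : admissible I alpha)
  (hs0 : I s0)
  (hnormal : normal_field I alpha n1)
  (hunit : unit_field I n1)
  (hRM : rotation_minimizing I alpha n1)
  (horient : frenet_oriented I alpha n1) :
  let t := tangent I alpha in
  let n := normal I alpha in
  let b := binormal in
  let kappa := curvature I alpha in
  let tau := torsion I alpha in
  exists tau0 : R,
    let theta := fun s => RInt tau s0 s + tau0 in
    let n2 := b in
    (forall s, I s -> ex_RInt tau s0 s) /\
    (forall s, I s -> n1 s = minus (n s) (scal (theta s) (b s))) /\
    exists kappa1 kappa2 : R -> R,
      (forall s, I s ->
         is_derive_on I t s
           (comb 0 (kappa1 s) (kappa2 s) (t s) (n1 s) (n2 s)) /\
         is_derive_on I n1 s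
           (comb (- kappa1 s) 0 0 (t s) (n1 s) (n2 s)) /\
         is_derive_on I n2 s
           (comb 0 0 0 (t s) (n1 s) (n2 s))) /\
      (forall s, I s ->
         kappa1 s = kappa s /\
         kappa s = kappa s * cosg (theta s) /\
         kappa2 s = kappa s * theta s /\
         kappa s * theta s = kappa s * sing (theta s)).
Proof.
  intros t n b kappa tau.
  (* With this value of tau0, theta is the z coordinate of n - n1. *)
  exists (zc (minus (n s0) (n1 s0))); intros theta n2.
  assert (Hint : forall s, I s -> is_RInt tau s0 s
            (zc (minus (n s) (n1 s)) - zc (minus (n s0) (n1 s0))))
    by (intros s Is; apply is_RInt_torsion; assumption).
  assert (Htheta : forall s, I s -> theta s = zc (n s) - zc (n1 s)).
  { intros s Is; unfold theta.
    rewrite (is_RInt_unique _ _ _ _ (Hint s Is)).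
    unfold minus; rewrite !zc_plus, !zc_opp; ring. }
  assert (Hn1 : forall s, I s -> n1 s = minus (n s) (scal (theta s) (b s))).
  { intros s Is.
    destruct (unit_normal_horizontal I alpha n1 s hI halpha hspeed hadm
                hnormal hunit horient Is) as [Hx Hy].
    unfold minus, b, binormal; apply vec_ext.
    - rewrite xc_plus, xc_opp, xc_scal, Hx.
      change (xc (0, 0, 1)) with 0; unfold n; ring.
    - rewrite yc_plus, yc_opp, yc_scal, Hy.
      change (yc (0, 0, 1)) with 0; unfold n; ring.
    - rewrite zc_plus, zc_opp, zc_scal, (Htheta s Is).
      change (zc (0, 0, 1)) with 1; ring. }
  split; [intros s Is; eexists; exact (Hint s Is) | split; [exact Hn1 |]].
  exists kappa, (fun s => kappa s * theta s); split.
  - intros s Is; split; [| split].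
    + assert (E : comb 0 (kappa s) (kappa s * theta s) (t s) (n1 s) (n2 s)
                  = Derive_on I t s).
      { pose proof (curvature_gt_0 I alpha s hadm Is) as Hk.
        unfold comb, n2; rewrite (Hn1 s Is); unfold minus, n, normal.
        fold t; fold kappa; fold kappa in Hk.
        apply vec_ext;
          rewrite ?xc_plus, ?yc_plus, ?zc_plus, ?xc_scal, ?yc_scal, ?zc_scal,
            ?xc_plus, ?yc_plus, ?zc_plus, ?xc_opp, ?yc_opp, ?zc_opp,
            ?xc_scal, ?yc_scal, ?zc_scal; field; lra. }
      rewrite E; apply (proj1 (tangent_derivatives I alpha halpha)), Is.
    + replace (comb (- kappa s) 0 0 (t s) (n1 s) (n2 s))
        with (scal (- kappa s) (t s)).
      * apply rotation_minimizing_derivative; assumption.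
      * unfold comb; apply vec_ext;
          rewrite ?xc_plus, ?yc_plus, ?zc_plus, ?xc_scal, ?yc_scal, ?zc_scal; ring.
    + replace (comb 0 0 0 (t s) (n1 s) (n2 s)) with (zero : vec).
      * exact (is_derive_on_const I (0, 0, 1) s).
      * unfold comb; apply vec_ext;
          rewrite ?xc_plus, ?yc_plus, ?zc_plus, ?xc_scal, ?yc_scal, ?zc_scal;
          unfold zero; cbn; ring.
  - intros s Is; unfold cosg, sing; repeat split; ring.
Qed.
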